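(* Let $\phi:\mathbb Z\to\mathbb C$ be a finitely supported function such that $|\hat\phi(\theta)|<1$ for all $\theta\in(-\pi,\pi]\setminus\{0\}$ and such that there exist a real number $\alpha$, a positive even integer $\nu$ and a complex number $\gamma$ with $\operatorname{Re}(\gamma)>0$ for which $$\hat\phi(\theta)=e^{i\alpha\theta-\gamma\theta^\nu(1+o(1))}\qquad\text{as }\theta\to0.$$ Then there are constants $C,c\in(0,\infty)$ such that for any $x\in\mathbb Z$ and any integer $n\ge1$, $$|\phi^{(n)}(x)|\le\frac{C}{n^{1/\nu}}\exp\left(-c\left(\frac{|x-\alpha n|}{n^{1/\nu}}\right)^{\frac{\nu}{\nu-1}}\right).$$
   Context: $\hat\phi(\theta)=\sum_{x\in\mathbb Z}\phi(x)e^{ix\theta}$. Convolution powers: $\phi^{(1)}=\phi$ and $\phi^{(n)}(x)=\sum_{y}\phi^{(n-1)}(y)\phi(x-y)$ for $n\ge2$. *)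

(* Defs.v *)
From mathcomp Require Import all_boot all_order all_algebra.
From mathcomp Require Import complex.
From mathcomp Require Import all_classical all_reals all_analysis.

Set Implicit Arguments.
Unset Strict Implicit.
Unset Printing Implicit Defensive.

Import Order.TTheory GRing.Theory Num.Theory.
Import numFieldNormedType.Exports.

Local Open Scope classical_set_scope.
Local Open Scope ring_scope.
Local Open Scope complex_scope.

Definition expC (R : realType) (z : R[i]) : R[i] :=
  (expR (complex.Re z))%:C *
    (cos (complex.Im z) +i* sin (complex.Im z)).

Definition finitely_supported (R : realType) (phi : int -> R[i]) : Prop :=
  finite_set [set x | phi x != 0].

(* The sum \sum_(x \in A) F x is the sum over the support of F on A when that
   support is finite, and 0 otherwise; every sum below that involves a finitely
   supported phi has finite support. *)
Definition fourier (R : realType) (phi : int -> R[i]) (theta : R) : R[i] :=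
  \sum_(x \in [set: int]) phi x * expC (0 +i* (x%:~R * theta)).

Definition convolve (R : realType) (psi phi : int -> R[i]) (x : int) : R[i] :=
  \sum_(y \in [set: int]) psi y * phi (x - y).

(* The n-th convolution power, for n >= 1; the value phi at n = 0 is junk. *)
Definition convpow (R : realType) (phi : int -> R[i]) (n : nat) : int -> R[i] :=
  iter n.-1 (fun psi => convolve psi phi) phi.

(* Main.v *)
Require Import Defs.
From mathcomp Require Import all_boot all_order all_algebra.
From mathcomp Require Import complex.
From mathcomp Require Import all_classical all_reals all_analysis.
From mathcomp Require Import ring lra zify.

Import Order.TTheory GRing.Theory Num.Theory.
Import numFieldNormedType.Exports.
Import ComplexField.Normc.

Set Implicit Arguments.
Unset Strict Implicit.
Unset Printing Implicit Defensive.

Local Open Scope classical_set_scope.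
Local Open Scope ring_scope.
Local Open Scope complex_scope.

(** The bound is a contour-shift (saddle point) estimate.  As phi has finite
    support, its Fourier transform extends to an entire function; write it as
    [e^(i alpha z) g(z)] with [g(z) = \sum_x phi(x) e^(i (x - alpha) z)].
    Shifting the inversion formula for the n-th convolution power from the
    real axis to height v gives, for every real v,
      [|phi^(n)(x)| <= e^(v (x - alpha n)) *
                       mean over u in [-pi, pi] of |g(u + i v)|^n].
    Everything then rests on one inequality, valid for [|u| <= pi] and all v:
      [|g(u + i v)| <= exp (M |v|^nu - c |u|^nu)].
    It turns the mean into [exp (n M |v|^nu)] times a quantity of order
    [n^(-1/nu)], and choosing v of size [(|x - alpha n| / n)^(1/(nu - 1))],
    with the sign that makes [v (x - alpha n)] negative, gives the theorem.

    The inequality for g is proved by regions ([expsum_estimate]).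
    Near 0, the expansion known on the real axis determines the Taylor
    polynomial of g, so [g(z) = 1 - gamma z^nu + O(|z|^(nu+1))] for complex z
    ([expsum_expansion]); where [|v|] is small against [|u|] the term
    [Re (gamma z^nu)] is close to [Re gamma * u^nu], and elsewhere [|u|] and
    [|z|] are both controlled by [|v|] ([near0_le]).  For u away from 0 and
    small v, compactness and a Lipschitz bound keep [|g|] below 1.  For v
    away from 0, the growth [A e^(B |v|)] is absorbed by [M |v|^nu].

    The shift is a finite computation.  If phi is supported in [-B, B], then
    [phi^(n)(x)] is a coefficient of the n-th power of the polynomial
    [\sum_k phi(k - B) X^k], and a coefficient is recovered exactly by
    averaging over roots of unity on any circle, the radius [e^(-v)] playing
    the role of the height v ([coef_le_mean], [convpow_contour]).  The number
    of nodes can be taken as large as one likes, and the resulting Riemann sum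
    is bounded by telescoping ([mean_gaussian_le]). *)

(** * Modulus of complex numbers *)

Lemma complex_normE (R : realType) (z : R[i]) : `|z| = (normc z)%:C.
Proof. by []. Qed.

Lemma normc_ge0 (R : realType) (z : R[i]) : 0 <= normc z.
Proof. by rewrite -ler0c -complex_normE. Qed.

Lemma normcX (R : realType) (z : R[i]) n : normc (z ^+ n) = normc z ^+ n.
Proof. by elim: n => [|n IH]; rewrite ?normc1 // !exprS normcM IH. Qed.

Lemma normcB (R : realType) (z w : R[i]) : normc (z - w) <= normc z + normc w.
Proof. by rewrite -(normcN w); exact: le_normcD. Qed.

Lemma normc_sum (R : realType) I (r : seq I) (P : pred I) (F : I -> R[i]) :
  normc (\sum_(i <- r | P i) F i) <= \sum_(i <- r | P i) normc (F i).
Proof.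
elim/big_rec2: _ => [|i y z _ h]; first by rewrite normc0.
by apply: le_trans (le_normcD _ _) _; rewrite lerD2l.
Qed.

Lemma normc_real (R : realType) (x : R) : normc x%:C = `|x|.
Proof. by rewrite /= expr0n addr0 sqrtr_sqr. Qed.

Lemma Re_le_normc (R : realType) (z : R[i]) : `|complex.Re z| <= normc z.
Proof. by rewrite -lecR; exact: normc_ge_Re. Qed.

Lemma normc_sqr (R : realType) (z : R[i]) :
  normc z ^+ 2 = complex.Re z ^+ 2 + complex.Im z ^+ 2.
Proof. by case: z => a b /=; rewrite sqr_sqrtr // addr_ge0 ?sqr_ge0. Qed.

Lemma normc_le_ReIm (R : realType) (z : R[i]) :
  normc z <= `|complex.Re z| + `|complex.Im z|.
Proof.
rewrite -(@ler_pXn2r _ 2) ?nnegrE ?normc_ge0 ?addr_ge0 //.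
rewrite normc_sqr -[complex.Re z ^+ 2]real_normK ?num_real //.
rewrite -[complex.Im z ^+ 2]real_normK ?num_real // sqrrD.
by rewrite lerD2r lerDl mulrn_wge0 // mulr_ge0.
Qed.

(** The modulus as a supremum of real parts: bounds for real-valued functions, such as
    those given by the mean value theorem, pass to complex-valued ones without loss. *)
Lemma normc_dual (R : realType) (z : R[i]) :
  exists2 c : R[i], normc c <= 1 & complex.Re (c * z) = normc z.
Proof.
have [->|z0] := eqVneq z 0.
  by exists 0; rewrite ?mulr0 ?normc0 // ler01.
have nz : normc z != 0 by apply: contra z0 => /eqP/eq0_normc ->.
(* the conjugate direction of z *)
exists ((normc z)^-1%:C * z^*).
  rewrite normcM normc_real ger0_norm ?invr_ge0 ?normc_ge0 //.
  have -> : normc z^* = normc z by case: z {z0 nz} => a b /=; rewrite sqrrN.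
  by rewrite mulVf.
have h : z^* * z = (normc z ^+ 2)%:C.
  rewrite normc_sqr; case: {z0 nz} z => a b; apply/eqP; rewrite eq_complex /=.
  by apply/andP; split; apply/eqP; ring.
by rewrite -mulrA h -rmorphM /= expr2 mulrA mulVf // mul1r.
Qed.

(** * The complex exponential and its Taylor tails *)

Lemma expC_def (R : realType) (a b : R) :
  expC (a +i* b) = (expR a * cos b) +i* (expR a * sin b).
Proof. by rewrite /expC /=; apply/eqP; rewrite eq_complex /=; apply/andP; split; apply/eqP; ring. Qed.

Lemma expC0 (R : realType) : expC (0 : R[i]) = 1.
Proof.
by rewrite (expC_def 0 0) expR0 cos0 sin0 mulr0 mulr1.
Qed.

Lemma expCD (R : realType) (z w : R[i]) : expC (z + w) = expC z * expC w.
Proof.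
case: z w => a b [c d]; rewrite -[_ + _]/((a + c) +i* (b + d)) !expC_def.
rewrite expRD cosD sinD.
by apply/eqP; rewrite eq_complex /=; apply/andP; split; apply/eqP; ring.
Qed.

Lemma normc_expC (R : realType) (z : R[i]) : normc (expC z) = expR (complex.Re z).
Proof.
rewrite /expC normcM normc_real ger0_norm ?expR_ge0 //=.
by rewrite cos2Dsin2 sqrtr1 mulr1.
Qed.

Lemma expCMn (R : realType) (z : R[i]) n : expC (n%:R * z) = expC z ^+ n.
Proof.
elim: n => [|n IH]; first by rewrite mul0r expC0.
by rewrite -add1n natrD mulrDl mul1r expCD IH exprS.
Qed.

(** The tail starts at degree n, hence is of order [w ^+ n].  Its radial derivative is
    [w] times the tail of one degree less, which drives the induction bounding it. *)
Definition expC_tail {R : realType} n (w : R[i]) :=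
  expC w - \sum_(k < n) w ^+ k / k`!%:R.

Lemma ReB (R : realType) (z w : R[i]) :
  complex.Re (z - w) = complex.Re z - complex.Re w.
Proof. by case: z w => a b [c d]. Qed.

Lemma expC_tailS (R : realType) n (w : R[i]) :
  expC_tail n.+1 w = expC_tail n w - w ^+ n / n`!%:R.
Proof. by rewrite /expC_tail big_ord_recr /= opprD addrA. Qed.

(** Differentiation along the ray through w removes one term of the Taylor polynomial; for
    [n = 0] the exponential is its own derivative, so [n.-1] is right in that case too. *)
Lemma is_derive_expC_tail (R : realType) n (c w : R[i]) (t : R) :
  is_derive t 1 (fun s : R => complex.Re (c * expC_tail n (s%:C * w)))
    (complex.Re (c * w * expC_tail n.-1 (t%:C * w))).
Proof.
elim: n c t => [|n IH] c t.
  case: c w => c d [a b].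
  have -> : (fun s : R => complex.Re ((c +i* d) * expC_tail 0 (s%:C * (a +i* b))))
      = (fun s => expR (s * a) * (c * cos (s * b) - d * sin (s * b))).
    apply/funext => s; rewrite /expC_tail big_ord0 subr0.
    have -> : s%:C * (a +i* b) = (s * a) +i* (s * b).
      by apply/eqP; rewrite eq_complex /=; apply/andP; split; apply/eqP; ring.
    by rewrite expC_def /=; ring.
  rewrite /expC_tail big_ord0 subr0.
  have -> : t%:C * (a +i* b) = (t * a) +i* (t * b).
    by apply/eqP; rewrite eq_complex /=; apply/andP; split; apply/eqP; ring.
  rewrite expC_def /=.
  have dlin (e : R) : is_derive t 1 (fun s : R => s * e) e.
    have -> : (fun s : R => s * e) = (e \*: (id : R -> R)).
      by apply/funext => s /=; rewrite mulrC.
    by apply: is_derive_eq (is_deriveZ _ (is_derive_id _ _)) _; rewrite /GRing.scale /= mulr1.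
  have dexp : is_derive t 1 (fun s => expR (s * a)) (expR (t * a) * a).
    exact: (is_derive1_comp (f := expR) (g := fun s => s * a)).
  have dcos : is_derive t 1 (fun s => cos (s * b)) (- sin (t * b) * b).
    exact: (is_derive1_comp (f := cos) (g := fun s => s * b)).
  have dsin : is_derive t 1 (fun s => sin (s * b)) (cos (t * b) * b).
    exact: (is_derive1_comp (f := sin) (g := fun s => s * b)).
  apply: (@is_derive_eq _ _ _
    ((fun s => expR (s * a)) * (c \*: (fun s => cos (s * b)) - d \*: (fun s => sin (s * b))))).
  have alg (E C S : R) : E * (c * (- S * b) - d * (C * b)) + (c * C - d * S) * (E * a)
      = (c * a - d * b) * (E * C) - (c * b + d * a) * (E * S) by ring.
  exact: alg.
set q := complex.Re (c * (w ^+ n / n`!%:R)).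
have -> : (fun s : R => complex.Re (c * expC_tail n.+1 (s%:C * w)))
   = (fun s => complex.Re (c * expC_tail n (s%:C * w))) - q \*: (fun s : R => s ^+ n).
  apply/funext => s.
  change (complex.Re (c * expC_tail n.+1 (s%:C * w)) =
    complex.Re (c * expC_tail n (s%:C * w)) - q * s ^+ n); rewrite /q.
  rewrite expC_tailS mulrBr [LHS]ReB; congr (_ - _).
  rewrite exprMn -rmorphXn /= -!mulrA mulrCA.
  by case: (c * _) => p r /=; ring.
have h : is_derive t 1 (fun s : R => s ^+ n) (n%:R * t ^+ n.-1 * 1).
  have -> : (fun s : R => s ^+ n) = (id : R -> R) ^+ n by apply/funext => s; rewrite exprfctE.
  exact: is_deriveX.
apply: is_derive_eq (is_deriveB (IH c t) (is_deriveZ q h)) _.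
change (complex.Re (c * w * expC_tail n.-1 (t%:C * w)) - q * (n%:R * t ^+ n.-1 * 1)
  = complex.Re (c * w * expC_tail n (t%:C * w))).
rewrite mulr1 /q.
case: n {IH h q} => [|n] /=.
  by rewrite mul0r mulr0 subr0.
have -> : c * w * expC_tail n.+1 (t%:C * w) =
    c * w * expC_tail n (t%:C * w) - c * w * ((t%:C * w) ^+ n / n`!%:R).
  by rewrite expC_tailS; ring.
rewrite [RHS]ReB; congr (_ - _).
rewrite exprMn -rmorphXn /=.
have -> : c * w * ((t ^+ n)%:C * w ^+ n / n`!%:R) =
    (n.+1%:R * t ^+ n)%:C * (c * (w ^+ n.+1 / (n.+1)`!%:R)).
  rewrite factS natrM invfM rmorphM /= rmorph_nat exprS.
  have n0 : n.+1%:R != 0 :> R[i] by rewrite pnatr_eq0.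
  have f0 : n`!%:R != 0 :> R[i] by rewrite pnatr_eq0 -lt0n fact_gt0.
  by field; rewrite nat1r f0 n0.
by case: (c * _) => p r /=; ring.
Qed.

(** Induction on n: the mean value theorem on the segment from 0 to w bounds a tail by [|w|]
    times the previous tail at an intermediate point. *)
Lemma normc_expC_tail_le (R : realType) n (w : R[i]) :
  normc (expC_tail n w) <= normc w ^+ n * expR (normc w).
Proof.
elim: n w => [|n IH] w.
  rewrite /expC_tail big_ord0 subr0 normc_expC mul1r ler_expR.
  by apply: le_trans (ler_norm _) (Re_le_normc w).
have [c c1 <-] := normc_dual (expC_tail n.+1 w).
pose F (s : R) := complex.Re (c * expC_tail n.+1 (s%:C * w)).
have dF (s : R) : is_derive s 1 F (complex.Re (c * w * expC_tail n (s%:C * w))).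
  exact: is_derive_expC_tail.
have F0 : F 0 = 0.
  rewrite /F mul0r /expC_tail expC0 big_ord_recl /= expr0 fact0 divr1.
  rewrite big1 ?addr0 ?subrr ?mulr0 // => i _.
  by rewrite exprS !mul0r.
have -> : complex.Re (c * expC_tail n.+1 w) = F 1 by rewrite /F mul1r.
have cF : {within `[0, 1 : R], continuous F}.
  apply: continuous_subspaceT => s.
  by apply: differentiable_continuous; apply/derivable1_diffP; case: (dF s).
have [xi] := MVT ltr01 (fun x _ => dF x) cF.
rewrite in_itv /= F0 subr0 subr0 mulr1 => /andP[xi0 xi1] ->.
apply: le_trans (ler_norm _) _; apply: le_trans (Re_le_normc _) _.
rewrite !normcM.
apply: (@le_trans _ _ (normc w * normc (expC_tail n (xi%:C * w)))).
  by rewrite ler_wpM2r ?normc_ge0 // ler_piMl ?normc_ge0.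
rewrite exprS -mulrA ler_wpM2l ?normc_ge0 //.
apply: le_trans (IH _) _.
have h : normc (xi%:C * w) <= normc w.
  by rewrite normcM normc_real ger0_norm ?(ltW xi0) // ler_piMl ?normc_ge0 // ltW.
by rewrite ler_pM ?expR_ge0 ?exprn_ge0 ?normc_ge0 ?ler_expR // lerXn2r ?nnegrE ?normc_ge0.
Qed.

(** * Sums of exponentials with real frequencies *)

(** On the imaginary direction these sums grow at most exponentially, because the
    frequencies [b k] are real; on the real axis they are bounded. *)
Definition expsum {R : realType} L (a : nat -> R[i]) (b : nat -> R) (z : R[i]) :=
  \sum_(k < L) a k * expC ('i * (b k)%:C * z).

Lemma normc_i (R : realType) : normc ('i : R[i]) = 1.
Proof. by rewrite /= expr0n expr1n add0r sqrtr1. Qed.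

Lemma expsum_growth (R : realType) L (a : nat -> R[i]) (b : nat -> R) :
  exists A B : R, [/\ 0 <= A, 0 <= B & forall u v : R,
    normc (expsum L a b (u +i* v)) <= A * expR (B * `|v|)].
Proof.
exists (\sum_(k < L) normc (a k)), (\sum_(k < L) `|b k|).
split; [by apply: sumr_ge0 => k _; exact: normc_ge0 | exact: sumr_ge0 |].
move=> u v; apply: le_trans (normc_sum _ _ _) _; rewrite mulr_suml.
apply: ler_sum => k _; rewrite normcM ler_wpM2l ?normc_ge0 //.
rewrite normc_expC ler_expR.
have -> : complex.Re ('i * (b k)%:C * (u +i* v)) = - (b k * v) by rewrite /=; ring.
apply: le_trans (ler_norm _) _; rewrite normrN normrM ler_wpM2r //.
rewrite (bigD1 k) //= lerDl; exact: sumr_ge0.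
Qed.

(** The constant does not depend on the real part u, as [e^(i b u)] has modulus 1. *)
Lemma expsum_Lipschitz (R : realType) L (a : nat -> R[i]) (b : nat -> R) :
  exists2 K : R, 0 <= K & forall (u : R) (w : R[i]), normc w <= 1 ->
    normc (expsum L a b (u%:C + w) - expsum L a b u%:C) <= K * normc w.
Proof.
exists (\sum_(k < L) normc (a k) * (`|b k| * expR `|b k|)).
  by apply: sumr_ge0 => k _; rewrite !mulr_ge0 ?normc_ge0 ?expR_ge0.
move=> u w w1; rewrite -sumrB mulr_suml.
apply: le_trans (normc_sum _ _ _) _; apply: ler_sum => k _.
rewrite mulrDr expCD.
have -> (x y z : R[i]) : x * (y * z) - x * y = x * (y * (z - 1)) by ring.
rewrite normcM -[leRHS]mulrA ler_wpM2l ?normc_ge0 // normcM normc_expC.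
have -> : complex.Re ('i * (b k)%:C * u%:C) = 0 by rewrite /=; ring.
rewrite expR0 mul1r.
have := normc_expC_tail_le 1 ('i * (b k)%:C * w).
rewrite /expC_tail big_ord_recl big_ord0 expr0 fact0 divr1 addr0 expr1.
move=> h; apply: le_trans h _.
rewrite !normcM normc_i normc_real mul1r -!mulrA ler_wpM2l //.
rewrite mulrC ler_wpM2r ?normc_ge0 // ler_expR ler_piMr //.
Qed.

Lemma expsum_Taylor (R : realType) L (a : nat -> R[i]) (b : nat -> R) n :
  exists q : {poly R[i]}, exists2 K : R, 0 <= K & (size q <= n)%N /\
    forall z, normc z <= 1 ->
      normc (expsum L a b z - q.[z]) <= K * normc z ^+ n.
Proof.
exists (\sum_(k < L) a k *: \poly_(j < n) (('i * (b k)%:C) ^+ j / j`!%:R)).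
exists (\sum_(k < L) normc (a k) * (`|b k| ^+ n * expR `|b k|)).
  by apply: sumr_ge0 => k _; rewrite !mulr_ge0 ?normc_ge0 ?expR_ge0 ?exprn_ge0.
split.
  apply: leq_trans (size_sum _ _ _) _; apply/bigmax_leqP => k _.
  by apply: leq_trans (size_scale_leq _ _) _; exact: size_poly.
move=> z z1; rewrite horner_sum -sumrB mulr_suml.
apply: le_trans (normc_sum _ _ _) _; apply: ler_sum => k _.
rewrite hornerZ -mulrBr normcM -[leRHS]mulrA ler_wpM2l ?normc_ge0 // horner_poly.
have -> : \sum_(j < n) ('i * (b k)%:C) ^+ j / j`!%:R * z ^+ j =
    \sum_(j < n) ('i * (b k)%:C * z) ^+ j / j`!%:R.
  by apply: eq_bigr => j _; rewrite [in RHS]exprMn mulrAC.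
apply: le_trans (normc_expC_tail_le n _) _.
rewrite !normcM normc_i normc_real mul1r exprMn -!mulrA.
rewrite ler_wpM2l ?exprn_ge0 // mulrC ler_wpM2r ?exprn_ge0 ?normc_ge0 //.
by rewrite ler_expR ler_piMr.
Qed.

(** The constant coefficient is the limit at 0, hence vanishes; dividing by ['X] lowers both
    the size of q and the order of smallness by one. *)
Lemma poly_littleo_eq0 (R : realType) n (q : {poly R[i]}) :
  (size q <= n.+1)%N ->
  (forall e : R, 0 < e -> exists2 d : R, 0 < d & forall t : R, 0 < `|t| < d ->
     normc q.[t%:C] <= e * `|t| ^+ n) ->
  q = 0.
Proof.
have eps0 (x : R[i]) : (forall e : R, 0 < e -> normc x <= e) -> x = 0.
  move=> h; apply: eq0_normc; apply/eqP; rewrite eq_le normc_ge0 andbT.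
  by apply/ler_addgt0Pl => e e0; rewrite addr0; exact: h.
elim: n q => [|n IH] q sq o.
  rewrite (size1_polyC sq) (eps0 q`_0) // => e e0.
  have [d d0 /(_ (d / 2))] := o e e0.
  rewrite (size1_polyC sq) hornerC coefC /= expr0 mulr1; apply.
  by rewrite ger0_norm; lra.
pose p : {poly R[i]} := \poly_(i < n.+1) q`_i.+1.
have qE : q = p * 'X + (q`_0)%:P.
  apply/polyP => i; rewrite coefD coefMX coefC coef_poly.
  case: i => [|i] /=; first by rewrite add0r.
  rewrite addr0; case: ltnP => // h; apply: nth_default.
  exact: leq_trans sq _.
have sp : (size p <= n.+1)%N by exact: size_poly.
have [K K0 pK] : exists2 K : R, 0 <= K & forall t : R, `|t| <= 1 -> normc p.[t%:C] <= K.
  exists (\sum_(i < n.+1) normc q`_i.+1).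
    by apply: sumr_ge0 => i _; exact: normc_ge0.
  move=> t t1; rewrite horner_poly; apply: le_trans (normc_sum _ _ _) _.
  apply: ler_sum => i _; rewrite normcM normcX normc_real ler_piMr ?normc_ge0 //.
  exact: exprn_ile1.
have q0 : q`_0 = 0.
  apply: eps0 => e e0.
  have e20 : 0 < e / 2 by lra.
  have [d d0 od] := o _ e20.
  have K10 : 0 < K + 1 by lra.
  pose t := Num.min (d / 2) (Num.min 1 (e / 2 / (K + 1))).
  have td : t <= d / 2 by rewrite /t ge_min lexx.
  have t1 : t <= 1 by rewrite /t !ge_min lexx ?orbT.
  have tK : t <= e / 2 / (K + 1) by rewrite /t !ge_min lexx ?orbT.
  have t0 : 0 < t by rewrite /t !lt_min ltr01 !divr_gt0.
  have nt : `|t| = t by rewrite gtr0_norm.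
  have := od t; rewrite nt t0 /= => /(_ ltac:(lra)) qt.
  have pt := pK t; rewrite nt in pt; have {}pt := pt t1.
  have -> : q`_0 = q.[t%:C] - p.[t%:C] * t%:C.
    by rewrite {2}qE hornerD hornerM hornerX hornerC; ring.
  apply: le_trans (normcB _ _) _; rewrite normcM normc_real nt.
  have h1 : e / 2 * t ^+ n.+1 <= e / 2.
    by rewrite ler_piMr ?(ltW e20) // exprn_ile1 // ltW.
  have h2 : normc p.[t%:C] * t <= e / 2.
    rewrite ler_pdivlMr // in tK; apply: le_trans tK.
    by rewrite mulrC ler_pM2l //; lra.
  lra.
rewrite qE q0 addr0 (IH p) ?mul0r // => e e0.
have [d d0 od] := o e e0; exists d => // t td; have := od t td.
rewrite qE q0 addr0 hornerM hornerX normcM normc_real exprSr mulrA.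
by rewrite ler_pM2r //; case/andP: td.
Qed.

(** An expansion known only on the real axis near 0 extends to the complex unit disc: the
    Taylor polynomial of the sum and [1 - gamma z^n] agree on the real axis up to [o(t^n)], and
    both have degree at most n, so they are equal. *)
Lemma expsum_expansion (R : realType) L (a : nat -> R[i]) (b : nat -> R)
    n (gamma : R[i]) (h : R -> R[i]) : (0 < n)%N ->
  (forall e : R, 0 < e -> exists2 d : R, 0 < d & forall t : R, 0 < `|t| < d ->
     normc (h t) <= e /\
     expsum L a b t%:C = expC (- (gamma * (t ^+ n)%:C * (1 + h t)))) ->
  exists2 K : R, 0 <= K & forall z, normc z <= 1 ->
    normc (expsum L a b z - (1 - gamma * z ^+ n)) <= K * normc z ^+ n.+1.
Proof.
move=> n0 hyp; have [q [K K0 [sq qK]]] := expsum_Taylor L a b n.+1.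
exists K => // z z1; suff <- : q.[z] = 1 - gamma * z ^+ n by exact: qK.
suff /eqP : q - (1 - gamma *: 'X^n) = 0.
  by rewrite subr_eq0 => /eqP ->; rewrite !hornerE.
apply: (@poly_littleo_eq0 _ n).
  rewrite (leq_trans (size_polyD _ _)) // geq_max sq size_polyN.
  rewrite (leq_trans (size_polyD _ _)) // geq_max size_poly1 /= size_polyN.
  by rewrite (leq_trans (size_scale_leq _ _)) // size_polyXn.
move=> e e0.
pose G := normc gamma; have G0 : 0 <= G by exact: normc_ge0.
pose M := K + 4 * G ^+ 2 * expR (2 * G) + 1.
have M0 : 0 < M by rewrite /M ltr_wpDl // addr_ge0 // !mulr_ge0 ?exprn_ge0 ?expR_ge0.
have e1 : 0 < Num.min 1 (e / 2 / (G + 1)) by rewrite lt_min ltr01 !divr_gt0 // ltr_wpDl.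
have [d d0 hd] := hyp _ e1.
exists (Num.min d (Num.min 1 (e / 2 / M))).
  by rewrite !lt_min d0 ltr01 !divr_gt0.
move=> t; rewrite !lt_min => /and4P[t0 td t1 tM].
have [] := hd t; first by rewrite t0.
rewrite le_min => /andP[h1 hG] gE.
pose w := - (gamma * (t ^+ n)%:C * (1 + h t)).
(* Three errors: Taylor's remainder, the quadratic tail of the exponential, and
   the contribution of h. *)
have -> : (q - (1 - gamma *: 'X^n)).[t%:C] =
    - (expsum L a b t%:C - q.[t%:C]) + expC_tail 2 w - gamma * (t ^+ n)%:C * h t.
  have -> : expC_tail 2 w = expC w - 1 - w.
    by rewrite !expC_tailS /expC_tail big_ord0 expr0 expr1 fact0 !divr1 subr0.
  have tnE : (t ^+ n)%:C = t%:C ^+ n by exact: rmorphXn.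
  have -> : (q - (1 - gamma *: 'X^n)).[t%:C] = q.[t%:C] - (1 - gamma * t%:C ^+ n).
    by rewrite !hornerE.
  by rewrite gE -/w; move: (expC w) => E; rewrite /w !tnE; ring.
have nt : normc t%:C = `|t| by exact: normc_real.
have qt : normc (expsum L a b t%:C - q.[t%:C]) <= K * `|t| * `|t| ^+ n.
  by rewrite -mulrA -exprS -nt; apply: qK; rewrite nt ltW.
have tn0 : 0 <= `|t| ^+ n by exact: exprn_ge0.
have tn1 : `|t| ^+ n <= `|t|.
  by rewrite -(prednK n0) exprS ler_piMr // exprn_ile1 // ltW.
have nw : normc w <= 2 * G * `|t| ^+ n.
  rewrite /w normcN !normcM normc_real normrX -/G.
  have : normc (1 + h t) <= 2.
    by apply: le_trans (le_normcD _ _) _; rewrite normc1; lra.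
  have -> : 2 * G * `|t| ^+ n = G * `|t| ^+ n * 2 by ring.
  by move=> h2; rewrite ler_wpM2l ?mulr_ge0.
have wt : normc (expC_tail 2 w) <= 4 * G ^+ 2 * expR (2 * G) * `|t| * `|t| ^+ n.
  apply: le_trans (normc_expC_tail_le 2 w) _.
  have -> : 4 * G ^+ 2 * expR (2 * G) * `|t| * `|t| ^+ n =
     (4 * G ^+ 2 * (`|t| * `|t| ^+ n)) * expR (2 * G) by ring.
  apply: ler_pM; rewrite ?expR_ge0 ?exprn_ge0 ?normc_ge0 //.
    apply: (@le_trans _ _ ((2 * G * `|t| ^+ n) ^+ 2)).
      by rewrite lerXn2r ?nnegrE ?normc_ge0 // !mulr_ge0.
    have -> : (2 * G * `|t| ^+ n) ^+ 2 = 4 * G ^+ 2 * (`|t| ^+ n * `|t| ^+ n) by ring.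
    by rewrite ler_wpM2l ?mulr_ge0 ?exprn_ge0 // ler_wpM2r.
  rewrite ler_expR; apply: le_trans nw _; rewrite ler_piMr ?mulr_ge0 //.
  exact: le_trans tn1 (ltW t1).
have ht : normc (gamma * (t ^+ n)%:C * h t) <= e / 2 * `|t| ^+ n.
  rewrite !normcM normc_real normrX -/G mulrAC ler_wpM2r //.
  rewrite ler_pdivlMr ?ltr_wpDl // in hG; apply: le_trans hG.
  by rewrite mulrC ler_wpM2l ?normc_ge0 // lerDl.
apply: le_trans (normcB _ _) _.
apply: le_trans (lerD (le_normcD _ _) ht) _; rewrite normcN.
apply: le_trans (lerD (lerD qt wt) (lexx _)) _.
rewrite -!mulrDl ler_wpM2r //.
suff : M * `|t| <= e / 2 by rewrite /M; nra.
by rewrite ltr_pdivlMr // in tM; rewrite mulrC ltW.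
Qed.

(** * Fourier inversion on a circle of arbitrary radius *)

Definition circle_point {R : realType} (t : R) : R[i] := expC (0 +i* t).

Lemma circle_pointE (R : realType) (t : R) : circle_point t = cos t +i* sin t.
Proof. by rewrite /circle_point expC_def expR0 !mul1r. Qed.

Lemma circle_pointX (R : realType) (t : R) n :
  circle_point t ^+ n = circle_point (n%:R * t).
Proof.
rewrite /circle_point -expCMn; congr expC.
rewrite -(rmorph_nat (real_complex R)).
by apply/eqP; rewrite eq_complex /=; apply/andP; split; apply/eqP; ring.
Qed.

Lemma circle_point_neq0 (R : realType) (t : R) : circle_point t != 0.
Proof.
apply/eqP => /(congr1 (@normc R)); rewrite normc_expC normc0 /= expR0.
by move/eqP; rewrite oner_eq0.
Qed.

Lemma circle_pointD (R : realType) (s t : R) :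
  circle_point (s + t) = circle_point s * circle_point t.
Proof. by rewrite /circle_point -expCD; congr expC; apply/eqP; rewrite eq_complex /= addr0 !eqxx. Qed.

Lemma root_unity_neq1 (R : realType) (N d : nat) : (0 < d < N)%N ->
  circle_point (2 * pi / N%:R : R) ^+ d != 1.
Proof.
case/andP=> d0 dN; rewrite circle_pointX circle_pointE.
set t : R := pi * d%:R / N%:R.
have N0 : 0 < N%:R :> R by rewrite ltr0n (leq_trans _ dN).
have t0 : 0 < t by rewrite /t divr_gt0 // mulr_gt0 ?pi_gt0 ?ltr0n.
have tpi : t < pi by rewrite /t ltr_pdivrMr // ltr_pM2l ?pi_gt0 // ltr_nat.
have -> : d%:R * (2 * pi / N%:R) = t *+ 2 by rewrite /t -mulr_natl; ring.
rewrite cos_mulr2n eq_complex /=; apply/negP => /andP[/eqP h _].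
have s0 : 0 < sin t by apply: sin_gt0_pi; rewrite t0.
have := cos2Dsin2 t; have : 0 < sin t ^+ 2 by rewrite exprn_gt0.
by move: h; rewrite -mulr_natl; lra.
Qed.

Lemma root_unityX (R : realType) (N : nat) : (0 < N)%N ->
  circle_point (2 * pi / N%:R : R) ^+ N = 1.
Proof.
move=> N0; rewrite circle_pointX mulrC divfK ?pnatr_eq0 -?lt0n //.
by rewrite circle_pointE mulr_natl cos2pi sin2pi.
Qed.

Lemma root_unity_inj (R : realType) (N k l : nat) : (k < N)%N -> (l < N)%N ->
  circle_point (2 * pi / N%:R : R) ^+ k = circle_point (2 * pi / N%:R) ^+ l -> k = l.
Proof.
wlog lekl : k l / (k <= l)%N => [hw kN lN h|kN lN].
  by case: (leqP k l) => [/hw|/ltnW/hw h']; [apply|apply/esym/h'].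
rewrite -{1}(subnKC lekl) exprD -{1}[_ ^+ k]mulr1.
move/(mulfI (expf_neq0 _ (circle_point_neq0 _))) => h.
apply/eqP; rewrite eqn_leq lekl /= leqNgt; apply/negP => ltkl.
have /negP : circle_point (2 * pi / N%:R : R) ^+ (l - k) != 1.
  by apply: root_unity_neq1; rewrite subn_gt0 ltkl /= (leq_ltn_trans (leq_subr _ _)).
by rewrite -h eqxx.
Qed.

(** The points [2 pi k / (2 m + 1)] for k from [- m] to m: a grid of the open interval
    from [- pi] to [pi], symmetric about 0. *)
Definition node {R : realType} m (j : nat) : R :=
  2 * pi * (j%:R - m%:R) / (2 * m + 1)%:R.

(** Orthogonality of characters: up to a constant factor, this is a geometric sum whose
    ratio is a root of unity other than 1. *)
Lemma sum_node_eq0 (R : realType) m k l : (k < 2 * m + 1)%N -> (l < 2 * m + 1)%N ->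
  k != l ->
  \sum_(j < 2 * m + 1) circle_point (node m j : R) ^+ l / circle_point (node m j) ^+ k = 0.
Proof.
set N := (2 * m + 1)%N => kN lN kl; have N0 : (0 < N)%N by rewrite /N addn1.
pose w : R[i] := circle_point (2 * pi / N%:R).
pose c : R[i] := circle_point (- (2 * pi * m%:R) / N%:R).
have nodeE j : circle_point (node m j) = c * w ^+ j.
  rewrite /c /w circle_pointX -circle_pointD /node -/N; congr circle_point; ring.
pose z := w ^+ l / w ^+ k.
have wn0 i : w ^+ i != 0 by rewrite expf_neq0 ?circle_point_neq0.
have z1 : z != 1.
  rewrite -subr_eq0 -(mulIr_eq0 _ (mulIf (wn0 k))) mulrBl divfK // mul1r subr_eq0.
  by apply: contra kl => /eqP/(root_unity_inj lN kN) ->.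
have zN : z ^+ N = 1.
  by rewrite /z exprMn exprVn -!exprM ![(_ * N)%N]mulnC !exprM root_unityX // !expr1n divr1.
have geo : \sum_(j < N) z ^+ j = 0.
  have /esym/eqP := subrX1 z N; rewrite zN subrr mulf_eq0 subr_eq0 (negPf z1) /=.
  by move/eqP.
rewrite (eq_bigr (fun j : 'I_N => c ^+ l / c ^+ k * z ^+ j)).
  by rewrite -mulr_sumr geo mulr0.
move=> j _; rewrite nodeE.
have alg (x y : R[i]) :
    (x * y ^+ j) ^+ l / (x * y ^+ j) ^+ k = x ^+ l / x ^+ k * (y ^+ l / y ^+ k) ^+ j.
  by rewrite !exprMn exprVn invfM -!exprM ![(_ * j)%N]mulnC; ring.
exact: alg.
Qed.

(** Discrete Cauchy estimate.  The average of [q(r w) / w^k] over the nodes is exactly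
    [q_k r^k], since the number of nodes exceeds the degree of q. *)
Lemma coef_le_mean (R : realType) (q : {poly R[i]}) m (r : R) k :
  (size q <= 2 * m + 1)%N -> 0 <= r ->
  normc q`_k * r ^+ k <=
    (2 * m + 1)%:R^-1 * \sum_(j < 2 * m + 1) normc q.[r%:C * circle_point (node m j)].
Proof.
set N := (2 * m + 1)%N => sq r0; have N0 : 0 < N%:R :> R by rewrite ltr0n /N addn1.
case: (ltnP k N) => kN; last first.
  rewrite nth_default ?(leq_trans sq) // normc0 mul0r mulr_ge0 ?invr_ge0 ?(ltW N0) //.
  by apply: sumr_ge0 => j _; exact: normc_ge0.
rewrite mulrC ler_pdivlMl //.
have <- : normc (\sum_(j < N) q.[r%:C * circle_point (node m j)]
     / circle_point (node m j) ^+ k) = N%:R * (r ^+ k * normc q`_k).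
  have -> : \sum_(j < N) q.[r%:C * circle_point (node m j)]
     / circle_point (node m j) ^+ k = N%:R * (r ^+ k)%:C * q`_k.
    rewrite (eq_bigr (fun j : 'I_N => \sum_(l < N) q`_l * (r ^+ l)%:C *
       (circle_point (node m j) ^+ l / circle_point (node m j) ^+ k))); last first.
      move=> j _; rewrite (horner_coef_wide _ sq) mulr_suml; apply: eq_bigr => l _.
      by rewrite exprMn rmorphXn /= !mulrA.
    rewrite exchange_big /= (bigD1 (Ordinal kN)) //= [X in _ + X]big1 ?addr0.
      rewrite -mulr_sumr (eq_bigr (fun=> 1)); last first.
        by move=> j _; rewrite divff // expf_neq0 ?circle_point_neq0.
      rewrite sumr_const card_ord; ring.
    move=> l lk; rewrite -mulr_sumr sum_node_eq0 ?mulr0 //.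
    by apply: contra lk => /eqP e; apply/eqP/val_inj.
  rewrite !normcM -[N%:R](rmorph_nat (real_complex R)) !normc_real.
  by rewrite ger0_norm ?(ltW N0) // ger0_norm ?exprn_ge0 // mulrA.
apply: le_trans (normc_sum _ _ _) _; apply: ler_sum => j _.
by rewrite normcM normcV normcX normc_expC /= expR0 expr1n invr1 mulr1.
Qed.

(** * Laurent polynomials *)

Lemma fsum_int (V : nmodType) (F : int -> V) N b :
  (forall y, F y != 0 -> exists2 k : nat, (k < N)%N & y = k%:Z - b%:Z) ->
  \sum_(y \in [set: int]) F y = \sum_(k < N) F (k%:Z - b%:Z).
Proof.
move=> h; rewrite (fsbigE [seq k%:Z - b%:Z | k <- iota 0 N]).
- rewrite big_map -{1}[N]subn0 -/(index_iota 0 N) (eq_bigl xpredT) ?big_mkord //.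
  by move=> k; rewrite in_setT.
- by rewrite map_inj_uniq ?iota_uniq // => k l /addIr [].
- by [].
- move=> y _; apply: contraNeq => /h[k kN ->]; apply/mapP; exists k => //.
  by rewrite mem_iota.
Qed.

(** The coefficient of [X^x] in [q / X^b], for any integer x. *)
Definition laurent {V : nzRingType} (q : {poly V}) (b : nat) (x : int) : V :=
  if x + b%:Z is Posz k then q`_k else 0.

Lemma convolve_laurent (R : realType) (q p : {poly R[i]}) b c :
  convolve (laurent q b) (laurent p c) = laurent (q * p) (b + c).
Proof.
apply/funext => x; rewrite /convolve.
pose i := if x + (b + c)%N%:Z is Posz i then i.+1 else 0%N.
rewrite (@fsum_int _ _ (size q + i) b); last first.
  move=> y; rewrite /laurent; case e : (y + b%:Z) => [k|k]; last by rewrite mul0r eqxx.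
  case: (ltnP k (size q)) => [kq _|/(nth_default 0) ->]; last by rewrite mul0r eqxx.
  by exists k; [rewrite ltn_addr | rewrite -e addrK].
rewrite (eq_bigr (fun k : 'I_(size q + i) =>
   q`_k * (if x + (b + c)%N%:Z - k%:Z is Posz j then p`_j else 0))); last first.
  move=> k _; rewrite /laurent subrK.
  by have -> : x - (k%:Z - b%:Z) + c%:Z = x + (b + c)%N%:Z - k%:Z by rewrite PoszD; ring.
rewrite /laurent /i; case e : (x + (b + c)%N%:Z) => [j|j].
  rewrite coefM (big_ord_widen _ (fun k => q`_k * p`_(j - k)) (leq_addl (size q) _)).
  rewrite [RHS]big_mkcond /=; apply: eq_bigr => k _.
  rewrite ltnS; case: leqP => h; first by rewrite subzn.
  case e' : (j%:Z - k%:Z) => [l|l]; last by rewrite mulr0.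
  by move: e'; lia.
rewrite big1 // => k _.
case e' : (Negz j - k%:Z) => [l|l]; last by rewrite mulr0.
by move: e'; lia.
Qed.

(** The radius [e^(-v)] in [coef_le_mean] is the height v: the point of the circle above
    the node u is [e^(i (u + i v))]. *)
Lemma laurent_le_mean (R : realType) (q : {poly R[i]}) b m (x : int) (v : R) :
  (size q <= 2 * m + 1)%N ->
  normc (laurent q b x) <= expR (v * (x%:~R + b%:R)) *
    ((2 * m + 1)%:R^-1 *
      \sum_(j < 2 * m + 1) normc q.[expC ('i * (node m j +i* v))]).
Proof.
move=> sq.
have mean k := @coef_le_mean R q m (expR (- v)) k sq (expR_ge0 _).
rewrite (eq_bigr (fun j : 'I_(2 * m + 1) =>
   normc q.[(expR (- v))%:C * circle_point (node m j)])); last first.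
  move=> j _; congr (normc (horner _ _)).
  have -> : 'i * (node m j +i* v) = (- v)%:C + (0 +i* node m j) :> R[i].
    by apply/eqP; rewrite eq_complex /=; apply/andP; split; apply/eqP; ring.
  by rewrite expCD [expC (- v)%:C]expC_def cos0 sin0 mulr0 mulr1.
rewrite /laurent; case e : (x + b%:Z) => [k|k]; last first.
  rewrite normc0 mulr_ge0 ?expR_ge0 // mulr_ge0 ?invr_ge0 ?ler0n //.
  by apply: sumr_ge0 => j _; exact: normc_ge0.
have -> : x%:~R + b%:R = k%:R :> R.
  by rewrite -[b%:R]/(b%:Z%:~R) -intrD e.
rewrite -ler_pdivrMl ?expR_gt0 // -expRN -mulNr mulrC expRM_natr.
exact: mean.
Qed.

(** * Convolution powers as averages on a horizontal line *)

Lemma finitely_supported_bound (R : realType) (phi : int -> R[i]) :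
  finitely_supported phi ->
  exists B : nat, forall x, phi x != 0 ->
    exists2 k : nat, (k < 2 * B + 1)%N & x = k%:Z - B%:Z.
Proof.
move=> /finite_seqP[s sE]; exists (\max_(x <- s) `|x|%N) => x x0.
have : x \in s by have : [set` s] x by rewrite -sE.
move=> xs; have xB : (`|x| <= \max_(x <- s) `|x|%N)%N by exact: leq_bigmax_seq.
move: (\max_(x <- s) _)%N xB => B xB.
by exists (absz (x + B%:Z)); lia.
Qed.

Definition symbol_poly {R : realType} (phi : int -> R[i]) B : {poly R[i]} :=
  \poly_(k < 2 * B + 1) phi (k%:Z - B%:Z).

Lemma convpow_laurent (R : realType) (phi : int -> R[i]) B n :
  (forall x, phi x != 0 -> exists2 k : nat, (k < 2 * B + 1)%N & x = k%:Z - B%:Z) ->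
  convpow phi n.+1 = laurent (symbol_poly phi B ^+ n.+1) (n.+1 * B).
Proof.
move=> phiB; have phiE : phi = laurent (symbol_poly phi B) B.
  apply/funext => x; rewrite /laurent.
  have [phi0|/phiB[k kB ->]] := eqVneq (phi x) 0; last first.
    by rewrite subrK coef_poly kB.
  case e : (x + B%:Z) => [k|k //]; rewrite coef_poly.
  by case: ifP => // _; rewrite -e addrK.
rewrite /convpow /=; elim: n => [|n IH] /=; first by rewrite expr1 mul1n.
by rewrite IH {2}phiE convolve_laurent -exprSr addnC -mulSn.
Qed.

Lemma fourier_sum (R : realType) (phi : int -> R[i]) B (theta : R) :
  (forall x, phi x != 0 -> exists2 k : nat, (k < 2 * B + 1)%N & x = k%:Z - B%:Z) ->
  fourier phi theta = \sum_(k < 2 * B + 1)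
     phi (k%:Z - B%:Z) * expC (0 +i* ((k%:R - B%:R) * theta)).
Proof.
move=> phiB; rewrite /fourier (@fsum_int _ _ (2 * B + 1) B).
  by apply: eq_bigr => k _; rewrite intrB.
by move=> y; case: (eqVneq (phi y) 0) => [->|/phiB //]; rewrite mul0r eqxx.
Qed.

(** Tilting by [e^(i alpha z)] centres the transform.  On the line of height v the tilt
    has modulus [e^(- alpha v)], which is how [alpha n] enters next to x.  The equality at
    [pi] and [- pi] reflects the 2 pi-periodicity of the modulus on the real axis. *)
Lemma convpow_contour (R : realType) (phi : int -> R[i]) (alpha : R) :
  finitely_supported phi ->
  exists L (a : nat -> R[i]) (b : nat -> R),
  let g := expsum L a b in
  [/\ forall theta : R, fourier phi theta = expC (0 +i* (alpha * theta)) * g theta%:C,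
      normc (g (- pi)%:C) = normc (g pi%:C) &
      forall n : nat, exists m0 : nat, forall m : nat, (m0 <= m)%N ->
      forall (x : int) (v : R),
        normc (convpow phi n.+1 x) <= expR (v * (x%:~R - alpha * n.+1%:R)) *
          ((2 * m + 1)%:R^-1 *
           \sum_(j < 2 * m + 1) normc (g (node m j +i* v)) ^+ n.+1)].
Proof.
move=> /finitely_supported_bound[B phiB].
exists (2 * B + 1)%N, (fun k => phi (k%:Z - B%:Z)), (fun k => k%:R - B%:R - alpha) => g.
have polyE (z : R[i]) : (symbol_poly phi B).[expC ('i * z)] =
    expC ('i * (B%:R + alpha)%:C * z) * g z.
  rewrite horner_poly mulr_sumr; apply: eq_bigr => k _ /=.
  rewrite [RHS]mulrCA -[in RHS]expCD -expCMn; congr (_ * expC _).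
  by rewrite !(rmorphD, rmorphB, rmorph_nat) /=; ring.
split.
- move=> theta; rewrite (fourier_sum _ phiB) mulr_sumr; apply: eq_bigr => k _.
  rewrite [RHS]mulrCA -[in RHS]expCD; congr (_ * expC _).
  by apply/eqP; rewrite eq_complex /=; apply/andP; split; apply/eqP; ring.
- have gE (t : R) : normc (g t%:C) = normc (symbol_poly phi B).[expC ('i * t%:C)].
    rewrite polyE normcM normc_expC.
    have -> : complex.Re ('i * (B%:R + alpha)%:C * t%:C) = 0 by rewrite /=; ring.
    by rewrite expR0 mul1r.
  have iE (t : R) : 'i * t%:C = 0 +i* t.
    by apply/eqP; rewrite eq_complex /=; apply/andP; split; apply/eqP; ring.
  by rewrite !gE !iE !expC_def sinN cosN sinpi oppr0.
(* enough nodes to separate the exponents of the n-th power *)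
move=> n; exists (size (symbol_poly phi B ^+ n.+1)) => m sm x v.
rewrite (convpow_laurent _ phiB).
apply: le_trans (@laurent_le_mean _ _ _ m x v _) _; first by lia.
rewrite (eq_bigr (fun j : 'I_(2 * m + 1) => expR (- (B%:R + alpha) * v) ^+ n.+1 *
   normc (g (node m j +i* v)) ^+ n.+1)); last first.
  move=> j _; rewrite horner_exp polyE normcX normcM normc_expC exprMn.
  by congr (expR _ ^+ _ * _); rewrite /=; ring.
have -> : expR (v * (x%:~R - alpha * n.+1%:R)) =
    expR (v * (x%:~R + (n.+1 * B)%:R)) * expR (- (B%:R + alpha) * v) ^+ n.+1.
  by rewrite -expRM_natl -expRD natrM; congr expR; ring.
by rewrite -mulr_sumr [(2 * m + 1)%:R^-1 * _]mulrCA -!mulrA.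
Qed.

(** * The modulus of the shifted transform *)

Lemma ReMr (R : realType) (z : R[i]) (x : R) :
  complex.Re (z * x%:C) = complex.Re z * x.
Proof. by case: z => a b /=; ring. Qed.

(** From [|1 - w| <= (1 + |1 - w|^2) / 2], expanding the square: the linear term [Re w] is kept
    exactly, which is what makes [Re gamma] appear in the decay rate. *)
Lemma normc_1B_le (R : realType) (w : R[i]) :
  normc (1 - w) <= 1 - complex.Re w + normc w ^+ 2.
Proof.
have := normc_sqr (1 - w); have := normc_sqr w.
move: (normc (1 - w)) (normc w) => s t; case: w => x y /= tE sE.
by nra.
Qed.

Lemma normc_subX_le (R : realType) (z w : R[i]) (n : nat) (r : R) :
  normc z <= r -> normc w <= r ->
  normc (z ^+ n - w ^+ n) <= n%:R * normc (z - w) * r ^+ n.-1.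
Proof.
move=> zr wr; have r0 : 0 <= r by apply: le_trans zr; exact: normc_ge0.
rewrite subrXX normcM [leRHS]mulrAC [leRHS]mulrC ler_wpM2l ?normc_ge0 //.
apply: le_trans (normc_sum _ _ _) _.
apply: (@le_trans _ _ (\sum_(i < n) r ^+ n.-1)).
  apply: ler_sum => i _; rewrite normcM !normcX.
  have -> : r ^+ n.-1 = r ^+ (n.-1 - i) * r ^+ i.
    rewrite -exprD; congr (_ ^+ _); have := ltn_ord i; lia.
  by apply: ler_pM; rewrite ?exprn_ge0 ?normc_ge0 // lerXn2r ?nnegrE ?normc_ge0.
by rewrite sumr_const card_ord mulr_natl.
Qed.

(** Write [s = |u|] and [t = |v|].  In the sector [t <= kap * s], replacing [Re (gamma z^n)] by
    [Re gamma * s^n] and bounding the error term costs at most half of [Re gamma * s^n], once kap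
    and s are small.  Outside the sector [|z|] and [s] are at most [La * t], so every term is
    absorbed by [M * t^n]. *)
Lemma near0_le (R : realType) (g : R[i] -> R[i]) (gamma : R[i]) n (K : R) :
  (0 < n)%N -> ~~ odd n -> 0 < complex.Re gamma -> 0 <= K ->
  (forall z, normc z <= 1 ->
    normc (g z - (1 - gamma * z ^+ n)) <= K * normc z ^+ n.+1) ->
  exists d a M : R, [/\ 0 < d, 0 < a, 0 <= M & forall u v : R,
    `|u| <= d -> `|v| <= d -> normc (g (u +i* v)) <= expR (M * `|v| ^+ n - a * `|u| ^+ n)].
Proof.
move=> n0 nev; set r := complex.Re gamma => r0 K0 gK.
pose G := normc gamma; have G0 : 0 <= G by exact: normc_ge0.
pose K' := K + G ^+ 2; have K'0 : 0 <= K' by rewrite addr_ge0 ?exprn_ge0.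
have gle z : normc z <= 1 ->
    normc (g z) <= 1 - complex.Re (gamma * z ^+ n) + K' * normc z ^+ n.+1.
  move=> z1; have z0 := normc_ge0 z.
  have -> : g z = (g z - (1 - gamma * z ^+ n)) + (1 - gamma * z ^+ n) by ring.
  apply: le_trans (le_normcD _ _) _.
  apply: le_trans (lerD (gK z z1) (normc_1B_le _)) _.
  have : normc (gamma * z ^+ n) ^+ 2 <= G ^+ 2 * normc z ^+ n.+1.
    rewrite normcM normcX exprMn ler_wpM2l ?exprn_ge0 // -exprM.
    by apply: ler_wiXn2l => //; lia.
  by rewrite /K'; lra.
pose P : R := 2 ^+ n.-1; have P0 : 0 < P by exact: exprn_gt0.
pose Q := G * n%:R * P; have Q0 : 0 <= Q by rewrite !mulr_ge0 // ltW.
pose kap : R := Num.min 1 (r / 4 / (Q + 1)).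
have kap0 : 0 < kap by rewrite lt_min ltr01 !divr_gt0 // ltr_wpDl.
have kap1 : kap <= 1 by rewrite ge_min lexx.
have kapQ : Q * kap <= r / 4.
  have : kap <= r / 4 / (Q + 1) by rewrite ge_min lexx orbT.
  rewrite ler_pdivlMr ?ltr_wpDl // => h; apply: le_trans h.
  by rewrite mulrC ler_wpM2l ?ltW //; lra.
pose S := K' * 2 ^+ n.+1; have S0 : 0 <= S by rewrite mulr_ge0 // exprn_ge0.
pose d : R := Num.min 2^-1 (r / 4 / (S + 1)).
have d0 : 0 < d by rewrite lt_min invr_gt0 ltr0n !divr_gt0 // ltr_wpDl.
have d2 : d <= 2^-1 by rewrite ge_min lexx.
have dS (s : R) : 0 <= s -> s <= d -> S * s <= r / 4.
  move=> s0 sd; have : d <= r / 4 / (S + 1) by rewrite ge_min lexx orbT.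
  rewrite ler_pdivlMr ?ltr_wpDl // => h; apply: le_trans h.
  apply: (@le_trans _ _ (S * d)); first by rewrite ler_wpM2l.
  by rewrite mulrC ler_wpM2l ?ltW //; lra.
pose La := kap^-1 + 1; have La0 : 0 < La by rewrite addr_gt0 ?invr_gt0.
have M0 : 0 <= (G + K' + r / 2) * La ^+ n.
  by rewrite mulr_ge0 ?exprn_ge0 ?(ltW La0) //; lra.
exists d, (r / 2), ((G + K' + r / 2) * La ^+ n); split => //.
  by rewrite divr_gt0.
move=> u v ud vd; set z := u +i* v.
have zle : normc z <= `|u| + `|v| by exact: normc_le_ReIm.
have z0 := normc_ge0 z.
have z1 : normc z <= 1 by lra.
have uz : normc u%:C <= normc z.
  by rewrite normc_real; exact: (Re_le_normc z).
(* inside the sector, then outside *)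
have [kuv|uvk] := leP `|v| (kap * `|u|).
  have zu : normc z <= 2 * `|u| by have := normr_ge0 u; nra.
  apply: le_trans (gle z z1) _.
  apply: (@le_trans _ _ (1 + - (r / 2 * `|u| ^+ n))); last first.
    apply: le_trans (expR_ge1Dx _) _; rewrite ler_expR lerDr.
    by rewrite mulr_ge0 ?exprn_ge0.
  have un : complex.Re (gamma * u%:C ^+ n) = r * `|u| ^+ n.
    have -> : u%:C ^+ n = (u ^+ n)%:C by rewrite rmorphXn.
    (* n is even *)
    have -> : `|u| ^+ n = u ^+ n by rewrite -normrX ger0_norm // exprn_even_ge0.
    exact: ReMr.
  have re : r * `|u| ^+ n - complex.Re (gamma * z ^+ n) <= r / 4 * `|u| ^+ n.
    rewrite -un -ReB -mulrBr; apply: le_trans (ler_norm _) _.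
    apply: le_trans (Re_le_normc _) _; rewrite normcM -/G.
    have := @normc_subX_le R u%:C z n (2 * `|u|) (le_trans uz zu) zu.
    have -> : u%:C - z = 0 +i* (- v).
      by apply/eqP; rewrite eq_complex /=; apply/andP; split; apply/eqP; ring.
    have -> : normc (0 +i* - v) = `|v| by rewrite /= expr0n add0r sqrtr_sqr normrN.
    move=> h; apply: le_trans (ler_wpM2l G0 h) _.
    rewrite exprMn -/P.
    apply: (@le_trans _ _ (G * (n%:R * (kap * `|u|) * (P * `|u| ^+ n.-1)))).
      have c0 : 0 <= P * `|u| ^+ n.-1 by rewrite mulr_ge0 ?exprn_ge0 ?(ltW P0).
      by rewrite ler_wpM2l // ler_wpM2r // ler_wpM2l.
    have -> : G * (n%:R * (kap * `|u|) * (P * `|u| ^+ n.-1)) = Q * kap * `|u| ^+ n.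
      by rewrite -{3}(prednK n0) exprS /Q; ring.
    by rewrite ler_wpM2r // exprn_ge0.
  have kz : K' * normc z ^+ n.+1 <= r / 4 * `|u| ^+ n.
    apply: (@le_trans _ _ (K' * (2 * `|u|) ^+ n.+1)).
      by rewrite ler_wpM2l // lerXn2r ?nnegrE ?mulr_ge0.
    have -> : K' * (2 * `|u|) ^+ n.+1 = S * `|u| * `|u| ^+ n.
      by rewrite exprMn /S [`|u| ^+ n.+1]exprS; ring.
    by rewrite ler_wpM2r ?exprn_ge0 // dS.
  by lra.
have uk : `|u| <= kap^-1 * `|v| by rewrite ler_pdivlMl // ltW.
have zL : normc z <= La * `|v| by rewrite /La; lra.
have uL : `|u| <= La * `|v| by have := normr_ge0 v; rewrite /La; lra.
apply: le_trans (gle z z1) _.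
apply: (@le_trans _ _ (1 + (G + K') * normc z ^+ n)).
  have h1 : - complex.Re (gamma * z ^+ n) <= G * normc z ^+ n.
    apply: le_trans (ler_norm _) _; rewrite normrN.
    by apply: le_trans (Re_le_normc _) _; rewrite normcM normcX.
  have h2 : K' * normc z ^+ n.+1 <= K' * normc z ^+ n.
    by rewrite ler_wpM2l // ler_wiXn2l.
  by lra.
apply: le_trans (expR_ge1Dx _) _; rewrite ler_expR.
have h3 : normc z ^+ n <= La ^+ n * `|v| ^+ n.
  by rewrite -exprMn lerXn2r ?nnegrE // mulr_ge0 // ltW.
have h4 : `|u| ^+ n <= La ^+ n * `|v| ^+ n.
  by rewrite -exprMn lerXn2r ?nnegrE // mulr_ge0 // ltW.
have h5 := ler_wpM2l (addr_ge0 G0 K'0) h3.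
have h6 := ler_wpM2l (ltW (divr_gt0 r0 (ltr0n R 2))) h4.
by lra.
Qed.

Lemma Lipschitz_continuous (R : realType) (f : R -> R) (K : R) :
  (forall u t : R, `|t| <= 1 -> `|f (u + t) - f u| <= K * `|t|) -> continuous f.
Proof.
move=> fK x; apply/cvgrPdist_le => e e0.
have K0 : 0 < `|K| + 1 by rewrite ltr_wpDl.
near=> y.
have xy1 : `|y - x| <= 1.
  by near: y; rewrite -nbhs_nearE; apply/nbhs_ballP; exists 1 => //= z; rewrite /ball /= distrC => /ltW.
have xye : `|y - x| <= e / (`|K| + 1).
  near: y; rewrite -nbhs_nearE; apply/nbhs_ballP; exists (e / (`|K| + 1)) => /=.
    by rewrite divr_gt0.
  by move=> z; rewrite /ball /= distrC => /ltW.
have := fK x _ xy1; rewrite [x + _]addrC subrK distrC => h.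
apply: le_trans h _.
rewrite ler_pdivlMr // in xye; apply: le_trans xye.
by rewrite mulrC ler_wpM2l // (le_trans (ler_norm _)) // lerDl.
Unshelve. all: by end_near. Qed.

(** Compactness: a continuous function attains its maximum on a segment. *)
Lemma lt1_uniform (R : realType) (f : R -> R) (s t : R) : s <= t -> continuous f ->
  (forall u, s <= u <= t -> f u < 1) ->
  exists2 e : R, 0 < e & forall u, s <= u <= t -> f u <= 1 - e.
Proof.
move=> st cf f1.
have [c cst fc] := EVT_max st (continuous_subspaceT cf).
exists (1 - f c); first by rewrite subr_gt0 f1 // -in_itv.
by move=> u ust; rewrite subKr fc // in_itv.
Qed.

(** Three regions: [|v| >= eta] (exponential growth against a power of v), [|v| < eta] with
    [|u| > d] (compactness, then the Lipschitz bound in v), and the neighbourhood of 0, treated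
    by [near0_le]. *)
Lemma expsum_estimate (R : realType) L (a : nat -> R[i]) (b : nat -> R)
    (gamma : R[i]) n (K : R) :
  let g := expsum L a b in
  (0 < n)%N -> ~~ odd n -> 0 < complex.Re gamma -> 0 <= K ->
  (forall z, normc z <= 1 ->
    normc (g z - (1 - gamma * z ^+ n)) <= K * normc z ^+ n.+1) ->
  (forall u : R, 0 < `|u| <= pi -> normc (g u%:C) < 1) ->
  exists c M : R, [/\ 0 < c, 0 < M & forall u v : R, `|u| <= pi ->
    normc (g (u +i* v)) <= expR (M * `|v| ^+ n - c * `|u| ^+ n)].
Proof.
move=> g n0 nev r0 K0 gK g1.
have [d0 [c1 [M1 [d00 c10 M10 near0]]]] := near0_le n0 nev r0 K0 gK.
have [Lc Lc0 gL] := expsum_Lipschitz L a b; rewrite -/g in gL.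
have [A [B [A0 B0 gA]]] := expsum_growth L a b; rewrite -/g in gA.
have pi0 : 0 < pi :> R := pi_gt0 R.
pose d := Num.min d0 pi.
have d0' : 0 < d by rewrite lt_min d00.
have dd : d <= d0 by rewrite ge_min lexx.
have dpi : d <= pi by rewrite ge_min lexx orbT.
(* Continuity for both orientations s = 1 and s = -1, to cover [d, pi] and [-pi, -d]. *)
have cg (s : R) : `|s| = 1 -> continuous (fun u : R => normc (g (s * u)%:C)).
  move=> s1; apply: (@Lipschitz_continuous _ _ Lc) => u t t1.
  have nst : normc (s * t)%:C = `|t| by rewrite normc_real normrM s1 mul1r.
  have := gL (s * u) (s * t)%:C; rewrite nst => /(_ t1) h.
  rewrite mulrDr rmorphD /=.
  apply: le_trans h.
  have trD (z w : R[i]) : normc z <= normc w + normc (z - w).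
    by rewrite -{1}(subrK w z) addrC; apply: le_trans (le_normcD _ _) _; rewrite addrC.
  have nC (z w : R[i]) : normc (z - w) = normc (w - z) by rewrite -normcN opprB.
  have := trD (g (s * u + s * t)%:C) (g (s * u)%:C).
  have := trD (g (s * u)%:C) (g (s * u + s * t)%:C).
  rewrite (nC (g (s * u)%:C)) rmorphD /= ler_norml; lra.
have [e1 e10 ge1] : exists2 e : R, 0 < e & forall u, d <= u <= pi -> normc (g (1 * u)%:C) <= 1 - e.
  apply: lt1_uniform => //; first by apply: cg; rewrite normr1.
  move=> u /andP[du upi]; apply: g1; rewrite mul1r gtr0_norm ?upi ?andbT; lra.
have [e2 e20 ge2] : exists2 e : R, 0 < e & forall u, d <= u <= pi -> normc (g (-1 * u)%:C) <= 1 - e.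
  apply: lt1_uniform => //; first by apply: cg; rewrite normrN1.
  move=> u /andP[du upi]; apply: g1; rewrite mulN1r normrN gtr0_norm ?upi ?andbT; lra.
pose e := Num.min e1 e2.
have e0 : 0 < e by rewrite lt_min e10.
have ge (u : R) : d <= `|u| <= pi -> normc (g u%:C) <= 1 - e.
  have ee1 : e <= e1 by rewrite ge_min lexx.
  have ee2 : e <= e2 by rewrite ge_min lexx orbT.
  have [u0|u0] := ler0P u => h.
    by have := ge2 _ h; rewrite mulN1r opprK; lra.
  by have := ge1 _ h; rewrite mul1r; lra.
pose eta := Num.min d (Num.min 1 (e / 2 / (Lc + 1))).
have Lc1 : 0 < Lc + 1 by lra.
have eta0 : 0 < eta by rewrite lt_min d0' /= lt_min ltr01 !divr_gt0.
have etad : eta <= d by rewrite ge_min lexx.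
have eta1 : eta <= 1 by rewrite ge_min orbC ge_min lexx.
have etaL : Lc * eta <= e / 2.
  have : eta <= e / 2 / (Lc + 1) by rewrite ge_min orbC ge_min lexx orbT.
  by rewrite ler_pdivlMr //; nra.
have pin : 0 < pi ^+ n :> R by exact: exprn_gt0.
have upin (u : R) : `|u| <= pi -> `|u| ^+ n <= pi ^+ n.
  by move=> h; rewrite lerXn2r ?nnegrE // ltW.
pose c := Num.min c1 (e / 2 / pi ^+ n).
have c0 : 0 < c by rewrite lt_min c10 !divr_gt0.
have cc1 : c <= c1 by rewrite ge_min lexx.
have ce : c * pi ^+ n <= e / 2.
  by rewrite -ler_pdivlMr // ge_min lexx orbT.
pose T := A + c * pi ^+ n + B * eta.
have T0 : 0 <= T by rewrite !addr_ge0 // mulr_ge0 // ltW.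
pose M2 := T / eta ^+ n.
have M20 : 0 <= M2 by rewrite divr_ge0 // exprn_ge0 // ltW.
exists c, (M1 + M2 + 1); split => //; first by lra.
move=> u v upi; have vn0 : 0 <= `|v| ^+ n by rewrite exprn_ge0.
have un0 : 0 <= `|u| ^+ n by rewrite exprn_ge0.
have [veta|etav] := ltP `|v| eta.
  have [ud|du] := leP `|u| d.
    apply: le_trans (near0 u v _ _) _; [lra|lra|].
    by rewrite ler_expR; nra.
  have -> : u +i* v = u%:C + (0 +i* v).
    by apply/eqP; rewrite eq_complex /=; apply/andP; split; apply/eqP; ring.
  have nv : normc (0 +i* v) = `|v| by rewrite /= expr0n add0r sqrtr_sqr.
  have := gL u (0 +i* v); rewrite nv => /(_ ltac:(lra)) h.
  have := ge u; rewrite (ltW du) upi => /(_ isT) h2.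
  rewrite -(subrK (g u%:C) (g _)); apply: le_trans (le_normcD _ _) _.
  apply: (@le_trans _ _ (1 + - (e / 2))).
    have : Lc * `|v| <= Lc * eta by rewrite ler_wpM2l // ltW.
    by lra.
  apply: le_trans (expR_ge1Dx _) _; rewrite ler_expR.
  have : c * `|u| ^+ n <= c * pi ^+ n by rewrite ler_wpM2l ?upin // ltW.
  have : 0 <= (M1 + M2 + 1) * `|v| ^+ n by rewrite mulr_ge0 //; lra.
  by lra.
apply: le_trans (gA u v) _.
apply: (@le_trans _ _ (expR (A + B * `|v|))).
  rewrite expRD ler_wpM2r ?expR_ge0 //.
  by apply: le_trans (expR_ge1Dx A); lra.
rewrite ler_expR.
(* As q >= 1, constants and terms linear in |v| are bounded by multiples of q^n. *)
pose q := `|v| / eta.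
have q1 : 1 <= q by rewrite /q ler_pdivlMr // mul1r.
have qn : q <= q ^+ n by rewrite ler_eXnr.
have vE : `|v| = q * eta by rewrite /q divfK // gt_eqF.
have M2E : M2 * `|v| ^+ n = T * q ^+ n.
  by rewrite /M2 /q expr_div_n; ring.
have : c * `|u| ^+ n <= c * pi ^+ n by rewrite ler_wpM2l ?upin // ltW.
have h1 : 0 <= (M1 + 1) * `|v| ^+ n by rewrite mulr_ge0 //; lra.
have -> : (M1 + M2 + 1) * `|v| ^+ n = (M1 + 1) * `|v| ^+ n + T * q ^+ n.
  by rewrite -M2E; ring.
have h2 : A <= A * q ^+ n by rewrite ler_peMr //; lra.
have h3 : c * pi ^+ n <= c * pi ^+ n * q ^+ n.
  by rewrite ler_peMr ?mulr_ge0 ?(ltW c0) ?(ltW pin) //; lra.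
have h4 : B * `|v| <= B * eta * q ^+ n.
  rewrite vE [q * _]mulrC mulrA ler_wpM2l // mulr_ge0 // ltW //.
rewrite /T !mulrDl; lra.
Qed.

(** * The mean of a generalized Gaussian over the nodes *)

(** Trades the exponential for an inverse square, whose sums over a grid can be telescoped.
    For large t this rests on [t^2 <= t^n]. *)
Lemma expR_pow_decay (R : realType) n (a t : R) : (2 <= n)%N -> 0 < a -> 0 <= t ->
  expR (- (a * t ^+ n)) <= (4 + 4 / a) / (1 + t) ^+ 2.
Proof.
move=> n2 a0 t0.
have t1 : 0 < (1 + t) ^+ 2 by rewrite exprn_gt0 //; lra.
rewrite ler_pdivlMr //.
have ia : 0 < 4 / a by rewrite divr_gt0.
have y0 : 0 <= a * t ^+ n by rewrite mulr_ge0 ?exprn_ge0 // ltW.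
have [tle|tgt] := leP t 1.
  apply: (@le_trans _ _ (1 * 4)); last by lra.
  apply: ler_pM; rewrite ?expR_ge0 ?(ltW t1) //; last by nra.
  by rewrite -[leRHS]expR0 ler_expR oppr_le0.
have tn : t ^+ 2 <= t ^+ n by rewrite ler_weXn2l // ltW.
have at0 : 0 < a * t ^+ 2 by rewrite mulr_gt0 // exprn_gt0 //; lra.
apply: (@le_trans _ _ ((a * t ^+ 2)^-1 * (4 * t ^+ 2))).
  apply: ler_pM; rewrite ?expR_ge0 ?(ltW t1) //; last by nra.
  rewrite expRN lef_pV2 ?posrE ?expR_gt0 //.
  have := expR_ge1Dx (a * t ^+ n).
  have : a * t ^+ 2 <= a * t ^+ n by rewrite ler_wpM2l // ltW.
  by lra.
have -> : (a * t ^+ 2)^-1 * (4 * t ^+ 2) = 4 / a.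
  field; rewrite ?gt_eqF //; lra.
by lra.
Qed.

(** [1 / b^2 <= 1 / (a b)] for [0 < a <= b], and consecutive [1 / (a b)] telescope. *)
Lemma inv_sqr_le_telescope (R : realType) (x k : R) : 0 < x -> 0 <= k ->
  ((1 + x * (k + 1)) ^+ 2)^-1 <= x^-1 * ((1 + x * k)^-1 - (1 + x * (k + 1))^-1).
Proof.
move=> x0 k0.
have p0 : 0 < 1 + x * k by have := mulr_ge0 (ltW x0) k0; lra.
have p1 : 0 < 1 + x * (k + 1) by have := mulr_ge0 (ltW x0) k0; nra.
have -> : x^-1 * ((1 + x * k)^-1 - (1 + x * (k + 1))^-1) =
    ((1 + x * k) * (1 + x * (k + 1)))^-1.
  by field; rewrite !gt_eqF.
rewrite lef_pV2 ?posrE ?exprn_gt0 ?mulr_gt0 // expr2 ler_wpM2r ?(ltW p1) //.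
nra.
Qed.

Lemma sum_inv_sqr_le (R : realType) (x : R) m : 0 < x ->
  \sum_(i < m) ((1 + x * (i.+1)%:R) ^+ 2)^-1 <= x^-1.
Proof.
move=> x0; apply: (@le_trans _ _ (x^-1 * (1 - (1 + x * m%:R)^-1))).
  elim: m => [|m IH]; first by rewrite big_ord0 mulr0 addr0 invr1 subrr mulr0.
  rewrite big_ord_recr /=; apply: le_trans (lerD IH _) _.
    by rewrite -natr1; apply: inv_sqr_le_telescope.
  by rewrite -mulrDr natr1 addrA subrK.
rewrite ler_piMr ?invr_ge0 ?(ltW x0) // gerBl invr_ge0 addr_ge0 //.
by rewrite mulr_ge0 // ltW.
Qed.

(** The indices below and above m contribute one one-sided sum each, and j = m
    contributes the 1. *)
Lemma sum_dist_inv_sqr_le (R : realType) (x : R) m : 0 < x ->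
  \sum_(j < 2 * m + 1) ((1 + x * `|j%:R - m%:R|) ^+ 2)^-1 <= 1 + 2 * x^-1.
Proof.
move=> x0; pose f (j : nat) := ((1 + x * `|j%:R - m%:R|) ^+ 2)^-1.
rewrite -(big_mkord xpredT f).
rewrite (@big_cat_nat _ _ _ m) //=; last by lia.
have -> : (2 * m + 1 = m + m.+1)%N by lia.
have -> : \sum_(m <= j < m + m.+1) f j = \sum_(i < m.+1) f (i + m)%N.
  by rewrite -[X in index_iota X _]add0n big_addn addKn big_mkord.
rewrite big_nat_rev /= add0n big_mkord /f.
rewrite (eq_bigr (fun i : 'I_m => ((1 + x * i.+1%:R) ^+ 2)^-1)); last first.
  move=> i _; rewrite natrB //.
  have -> : m%:R - i.+1%:R - m%:R = - i.+1%:R :> R by ring.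
  by rewrite normrN normr_nat.
rewrite (eq_bigr (fun i : 'I_m.+1 => ((1 + x * i%:R) ^+ 2)^-1)); last first.
  by move=> i _; rewrite natrD addrK normr_nat.
rewrite big_ord_recl mulr0 addr0 expr1n invr1.
have h := sum_inv_sqr_le m x0; have := h.
rewrite /=; lra.
Qed.

(** Bounds the Riemann sum of [exp (- a (rho |u|)^n)]; with [rho = N^(1/n)] this is the mean of
    the N-th power of [exp (- a |u|^n)], of order [1 / rho].  The condition [rho <= 2 m + 1] makes
    the grid finer than the width of the peak. *)
Lemma mean_gaussian_le (R : realType) n (a : R) : (2 <= n)%N -> 0 < a ->
  exists2 C : R, 0 < C & forall (rho : R) m, 1 <= rho -> rho <= (2 * m + 1)%:R ->
    (2 * m + 1)%:R^-1 * \sum_(j < 2 * m + 1) expR (- (a * (rho * `|node m j|) ^+ n)) <= C / rho.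
Proof.
move=> n2 a0; pose C0 := 4 + 4 / a.
have C00 : 0 < C0 by rewrite addr_gt0 // divr_gt0.
exists (3 * C0); first by rewrite mulr_gt0.
move=> rho m rho1; set N : R := (2 * m + 1)%:R => rhoN.
have N0 : 0 < N by lra.
have pi1 : 2 <= pi :> R := pi_ge2 R.
pose x := rho * (2 * pi / N); have x0 : 0 < x by rewrite /x !(mulr_gt0, invr_gt0) //; lra.
rewrite ler_pdivrMl //.
apply: (@le_trans _ _ (C0 * (1 + 2 * x^-1))).
  apply: (@le_trans _ _ (\sum_(j < 2 * m + 1) C0 * ((1 + x * `|j%:R - m%:R|) ^+ 2)^-1)).
    apply: ler_sum => j _.
    have -> : rho * `|node m j| = x * `|j%:R - m%:R|.
      rewrite /node -/N /x normrM normfV (gtr0_norm N0) normrM (ger0_norm (_ : 0 <= 2 * pi)); last by lra.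
      by ring.
    by apply: expR_pow_decay => //; exact: mulr_ge0 (ltW x0) _.
  by rewrite -mulr_sumr ler_wpM2l ?(ltW C00) //; exact: sum_dist_inv_sqr_le.
have xE : x^-1 = N / rho / (2 * pi) by rewrite /x; field; rewrite !gt_eqF //; lra.
have h : 1 <= N / rho by rewrite ler_pdivlMr ?mul1r //; lra.
have h2 : x^-1 <= N / rho.
  rewrite xE ler_pdivrMr; last by lra.
  by rewrite ler_peMr //; lra.
have -> : N * (3 * C0 / rho) = C0 * (3 * (N / rho)) by ring.
by rewrite ler_wpM2l ?(ltW C00) //; lra.
Qed.

(** * Choice of the height, and the theorem *)

Lemma powR_invnK (R : realType) (t : R) k : 0 <= t -> (0 < k)%N ->
  (t `^ k%:R^-1) ^+ k = t.
Proof.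
move=> t0 k0; rewrite -powR_mulrn ?powR_ge0 // -powRrM mulVf ?powRr1 //.
by rewrite pnatr_eq0 -lt0n.
Qed.

(** With [s = (|y| / n)^(1/(nu-1))], both [s |y|] and [n s^nu] equal the quantity
    [(|y| / n^(1/nu))^(nu/(nu-1))].  Taking [|v| = la s] makes the gain linear in la and the cost of
    order [la^nu], so a small la leaves half of the gain. *)
Lemma optimal_tilt (R : realType) (M : R) nu : (2 <= nu)%N -> 0 < M ->
  exists2 c : R, 0 < c & forall (y : R) (n : nat), (0 < n)%N ->
    exists v : R, v * y + n%:R * (M * `|v| ^+ nu) <=
      - c * (`|y| / n%:R `^ nu%:R^-1) `^ (nu%:R / (nu%:R - 1)).
Proof.
case: nu => // k; rewrite ltnS => k0 M0.
pose la := (2 * (M + 1))^-1.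
have la0 : 0 < la by rewrite invr_gt0; lra.
have laM : M * la <= 2^-1.
  by rewrite /la invfM mulrCA ler_piMr ?invr_ge0 // ler_pdivrMr; lra.
have la1 : la <= 1.
  by rewrite /la invf_le1; lra.
exists (la / 2); first by rewrite divr_gt0.
move=> y n n0; have n0' : 0 < n%:R :> R by rewrite ltr0n.
pose s := (`|y| / n%:R) `^ k%:R^-1.
have s0 : 0 <= s by exact: powR_ge0.
have sk : s ^+ k = `|y| / n%:R by rewrite powR_invnK // divr_ge0 // ltW.
have yE : `|y| = n%:R * s ^+ k by rewrite sk mulrC divfK // gt_eqF.
pose rho := n%:R `^ k.+1%:R^-1 : R.
have rhoE : rho ^+ k.+1 = n%:R by rewrite powR_invnK // ltW.
have rho0 : 0 < rho by exact: powR_gt0.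
have -> : (`|y| / rho) `^ (k.+1%:R / (k.+1%:R - 1)) = n%:R * s ^+ k.+1.
  have -> : `|y| / rho = (rho * s) ^+ k.
    by rewrite yE -rhoE exprMn exprS; field; rewrite gt_eqF.
  have rs0 : 0 <= rho * s by rewrite mulr_ge0 // ltW.
  rewrite -powR_mulrn // -powRrM -[k.+1%:R - 1]/(_ - 1) -natr1 addrK mulrCA divff ?mulr1; last first.
    by rewrite pnatr_eq0 -lt0n.
  by rewrite natr1 powR_mulrn // exprMn rhoE.
have [v vE vy] : exists2 v, `|v| = la * s & v * y = - (la * s * `|y|).
  have [y0|y0] := ler0P y; [exists (la * s)|exists (- (la * s))].
  - by rewrite ger0_norm // mulr_ge0 // ltW.
  - by ring.
  - by rewrite normrN ger0_norm // mulr_ge0 // ltW.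
  - by ring.
exists v; rewrite vE vy yE exprMn.
have -> : - (la * s * (n%:R * s ^+ k)) = - la * (n%:R * s ^+ k.+1) by rewrite exprS; ring.
have -> : n%:R * (M * (la ^+ k.+1 * s ^+ k.+1)) = M * la ^+ k.+1 * (n%:R * s ^+ k.+1) by ring.
rewrite -mulrDl ler_wpM2r ?mulr_ge0 ?exprn_ge0 ?(ltW n0') //.
have : M * la ^+ k.+1 <= la / 2.
  rewrite exprS mulrCA ler_pM2l //; apply: le_trans laM.
  rewrite ler_pM2l // -[leRHS]expr1; apply: ler_wiXn2l => //; exact: ltW.
lra.
Qed.

Lemma normr_lt1_normc (R : realType) (z : R[i]) : (`|z| < 1) = (normc z < 1).
Proof. by rewrite complex_normE -[1]/(1%:C) ltcR. Qed.

Lemma near_dnbhs0_normc (R : realType) (h : R -> R[i]^o) (P : R -> Prop) :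
  h t @[t --> (0 : R)^'] --> (0 : R[i]^o) ->
  (\forall t \near (0 : R)^', P t) ->
  forall e : R, 0 < e -> exists2 d : R, 0 < d & forall t : R, 0 < `|t| < d ->
    normc (h t : R[i]) <= e /\ P t.
Proof.
move=> h0 hP e e0.
have e0' : 0 < (e%:C : R[i]) by rewrite ltcR.
have /cvgrPdist_le /(_ _ e0') he := h0.
have [d /= d0 hd] := (filterI he hP).
exists d => // t /andP[t0 td].
have [] := hd t.
- by rewrite /ball /= sub0r normrN.
- by rewrite -normr_gt0.
- by rewrite sub0r normrN [`|_|]complex_normE lecR => ? ?; split.
Qed.

Theorem theorem3p1 (R : realType) (phi : int -> R[i])
    (alpha : R) (nu : nat) (gamma : R[i])
    (phi_fin : finitely_supported phi)
    (phi_lt1 : forall theta : R, - pi < theta <= pi -> theta != 0 ->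
       `|fourier phi theta| < 1)
    (nu_gt0 : (0 < nu)%N) (nu_even : ~~ odd nu)
    (gamma_gt0 : 0 < complex.Re gamma)
    (phi_expansion : exists h : R -> R[i]^o,
       h theta @[theta --> (0 : R)^'] --> (0 : R[i]^o) /\
       \forall theta \near (0 : R)^',
         fourier phi theta =
           expC ((0 +i* (alpha * theta))
                 - gamma * (theta ^+ nu)%:C * (1 + (h theta : R[i])))) :
  exists C c : R, [/\ 0 < C, 0 < c &
    forall (x : int) (n : nat), (1 <= n)%N ->
      `|convpow phi n x| <=
        (C / n%:R `^ nu%:R^-1 *
         expR (- c * (`|x%:~R - alpha * n%:R| / n%:R `^ nu%:R^-1)
                       `^ (nu%:R / (nu%:R - 1))))%:C].
Proof.
have nu2 : (2 <= nu)%N by case: nu nu_gt0 nu_even {phi_expansion} => [|[|]].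
have [L [a [b]]] := convpow_contour alpha phi_fin.
set g := expsum L a b => -[gF gpi gconv].
have normF (t : R) : normc (fourier phi t) = normc (g t%:C).
  by rewrite gF normcM normc_expC /= expR0 mul1r.
have g1 (u : R) : 0 < `|u| <= pi -> normc (g u%:C) < 1.
  case/andP; rewrite normr_gt0 => u0; rewrite ler_norml => /andP[].
  rewrite le_eqVlt => /orP[/eqP<- _|upi piu].
    rewrite gpi -normF -normr_lt1_normc phi_lt1 ?gt_eqF ?pi_gt0 //.
    by rewrite lexx andbT; have := pi_gt0 R; lra.
  by rewrite -normF -normr_lt1_normc phi_lt1 // upi.
have [h [h0 hF]] := phi_expansion.
have hyp := near_dnbhs0_normc h0 hF.
have [K K0 gK] : exists2 K : R, 0 <= K & forall z, normc z <= 1 ->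
    normc (g z - (1 - gamma * z ^+ nu)) <= K * normc z ^+ nu.+1.
  apply: (@expsum_expansion _ _ _ _ _ _ h) => // e e0.
  have [d d0 hd] := hyp e e0; exists d => // t /hd[he]; rewrite gF expCD => hE.
  split => //; apply: mulfI hE.
  by apply/eqP => /(congr1 (@normc R)); rewrite normc_expC normc0 /= expR0 => /eqP; rewrite oner_eq0.
have [c1 [M [c10 M0 est]]] := expsum_estimate nu_gt0 nu_even gamma_gt0 K0 gK g1.
have [C C0 mean] := mean_gaussian_le nu2 c10.
have [c c0 tilt] := optimal_tilt nu2 M0.
exists C, c; split => // x [//|n] _.
rewrite complex_normE lecR.
set rho : R := n.+1%:R `^ nu%:R^-1.
have rhoE : rho ^+ nu = n.+1%:R by rewrite powR_invnK.
have rho1 : 1 <= rho.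
  by rewrite -[1](powRr0 n.+1%:R) ler_powR ?ler1n // invr_ge0.
have [v hv] := tilt (x%:~R - alpha * n.+1%:R) n.+1 isT.
have [m0 conv] := gconv n.
(* enough nodes both for exact inversion and for [mean_gaussian_le] *)
pose m := maxn m0 n.+1.
have nodepi (j : 'I_(2 * m + 1)) : `|node m j : R| <= pi.
  have N0 : 0 < (2 * m + 1)%:R :> R by rewrite ltr0n addn1.
  rewrite /node normrM normfV (gtr0_norm N0) ler_pdivrMr // normrM.
  rewrite (ger0_norm (_ : 0 <= 2 * pi)); last by have := pi_gt0 R; lra.
  rewrite [2 * pi]mulrC -mulrA ler_pM2l ?pi_gt0 //.
  have : `|j%:R - m%:R| <= m%:R :> R.
    rewrite ler_norml; have := ler0n R j.
    have : j%:R <= (2 * m)%:R :> R by rewrite ler_nat; have := ltn_ord j; lia.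
    by rewrite natrM; lra.
  by rewrite natrD natrM; lra.
apply: le_trans (conv m (leq_maxl _ _) x v) _.
apply: (@le_trans _ _ (expR (v * (x%:~R - alpha * n.+1%:R) + n.+1%:R * (M * `|v| ^+ nu)) *
   ((2 * m + 1)%:R^-1 * \sum_(j < 2 * m + 1) expR (- (c1 * (rho * `|node m j|) ^+ nu))))).
  rewrite expRD -mulrA ler_wpM2l ?expR_ge0 // mulrCA ler_wpM2l ?invr_ge0 //.
  rewrite mulr_sumr; apply: ler_sum => j _.
  apply: le_trans (lerXn2r n.+1 _ _ (est _ v (nodepi j))) _;
    rewrite ?nnegrE ?normc_ge0 ?expR_ge0 //.
  (* As rho^nu = n.+1, the n.+1-st power of the bound at a node u is the bound at rho * u. *)
  rewrite -expRM_natl -expRD ler_expR exprMn rhoE; lra.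
rewrite mulrC ler_pM ?expR_ge0 //.
- by rewrite mulr_ge0 ?invr_ge0 // sumr_ge0 // => j _; exact: expR_ge0.
- apply: mean => //.
  apply: (@le_trans _ _ n.+1%:R).
    by rewrite -[leRHS]powRr1 // ler_powR ?ler1n // invf_le1 ?ltr0n // ler1n.
  by rewrite ler_nat; have := leq_maxr m0 n.+1; rewrite -/m; lia.
- by rewrite ler_expR.
Qed.
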